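(* Let $\bm{V}=\{X_1,\dots,X_N\}$ be generated by the linear structural equation model $X_i=\sum_{X_j\in \bm{PA}(X_i)}a_{ij}X_j+u_i$ ($X_i\in\bm V$), in vector form $\bm X=\bm A\bm X+\bm u$, and assume that (i) $\bm\Sigma=\mathrm{Var}(\bm u)$ is positive definite and (ii) $\bm A$ is lower triangular with all diagonal elements equal to zero. Let $G=(\bm V,\bm E,\bm B)$ be the causal path diagram associated with the model, and let $X_i\neq X_j$ be two vertices. For any subset $\bm Z\subset\bm V\setminus\{X_i,X_j\}$ that blocks every back-door path from $X_j$ to $X_i$, put $\bm S=\{X_j\}\cup\bm Z$ and $$\bm S_1=\{X_k\in\bm S\mid \bm S\setminus\{X_k\}\text{ opens a back-door path from }X_k\text{ to }X_i\},$$ $$\bm S_2=\{X_k\in\bm S\mid \bm S\setminus\{X_k\}\text{ blocks every back-door path from }X_k\text{ to }X_i\}.$$ Then the bias $\gamma_{ij\mid\bm Z}=\beta_{ij\mid\bm Z}-\tau_{ij\mid do(\bm Z)}$ of the coefficient $\beta_{ij\mid\bm Z}$ is given by $$\gamma_{ij\mid\bm Z}=-\sum_{X_p\in\bm S_1}\gamma_{ip\mid\bm S\setminus\{X_p\}}\,\tau_{pj\mid do(\bm S_2\setminus\{X_j\})}.$$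
   Context: **Model.** $\bm V=\{X_1,\dots,X_N\}$ is a finite set of random variables with nonzero variances (some possibly unobservable), with $X_i=\sum_{X_j\in\bm{PA}(X_i)}a_{ij}X_j+u_i$, where $\bm{PA}(X_i)\subset\bm V\setminus\{X_i\}$, each $a_{ij}$ with $X_j\in\bm{PA}(X_i)$ is a nonzero constant (path coefficient from $X_j$ to $X_i$), and $u_1,\dots,u_N$ are error terms with no specific distribution assumed (not necessarily mean zero, possibly correlated). $\bm X=(X_1,\dots,X_N)^\top$, $\bm u=(u_1,\dots,u_N)^\top$, and $\bm A$ is the $N\times N$ matrix with entries $a_{ij}$ (zero when $X_j\notin\bm{PA}(X_i)$). **Causal path diagram.** $G=(\bm V,\bm E,\bm B)$ has vertex set $\bm V$, a directed edge $X_j\to X_i$ for each $X_j\in\bm{PA}(X_i)$ (set $\bm E$), and a bidirected edge $X_i\leftrightarrow X_j$ for each pair $i\ne j$ with $\mathrm{Cov}(u_i,u_j)\neq0$ (set $\bm B$). It is an acyclic directed mixed graph; two vertices may be joined by both a directed and a bidirected edge. **Graph terminology.** A path is a sequence of distinct vertices in which consecutive vertices are adjacent (joined by a specified directed or bidirected edge). A directed path from $a$ to $b$ is a path all of whose edges are directed and oriented from $a$ toward $b$; then $b$ is a descendant of $a$. A back-door path from $a$ to $b$ is a path from $a$ to $b$ beginning with a bidirected edge or a directed edge pointing into $a$. A v-structure is a path of the form $a\to c\leftarrow b$, $a\to c\leftrightarrow b$, $a\leftrightarrow c\leftarrow b$ or $a\leftrightarrow c\leftrightarrow b$; $c$ is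 the collider. **Blocking.** Let $\bm W$ be a set containing neither endpoint of a path $P$. $\bm W$ blocks $P$ if (i) $\bm W$ contains a vertex on $P$ that is not a collider in any v-structure along $P$, or (ii) there is a v-structure along $P$ such that neither the collider nor any of its descendants belongs to $\bm W$. Otherwise $\bm W$ opens $P$. **Controlled total effect.** The total effect of $X_b$ on $X_a$ in a graph is the sum, over all directed paths from $X_b$ to $X_a$ in it, of the product of the path coefficients along the path (zero if there is none). For $\bm W\subset\bm V\setminus\{X_a,X_b\}$, $\tau_{ab\mid do(\bm W)}$ is the total effect of $X_b$ on $X_a$ in the subgraph obtained from $G$ by removing all edges with an arrowhead at a vertex in $\bm W$. **Partial regression coefficients and biases.** Let $\bm W$ be the random vector consisting of the constant $1$ and the variables in $\bm S$. The coefficient vector in the regression of $X_i$ on $\bm W$ is $\mathrm E[\bm W\bm W^\top]^{-1}\mathrm E[\bm W X_i]$; for $X_k\in\bm S$, $\beta_{ik\mid\bm S\setminus\{X_k\}}$ is its component corresponding to $X_k$ (so $\beta_{ij\mid\bm Z}$ is the component for $X_j$). For $X_k\in\bm S$ the bias is $\gamma_{ik\mid\bm S\setminus\{X_k\}}:=\beta_{ik\mid\bm S\setminus\{X_k\}}-\tau_{ik\mid do(\bm S\setminus\{X_k\})}$. *)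

(* Defs.v *)
From HB Require Import structures.
From mathcomp Require Import all_boot all_order all_algebra.
From mathcomp Require Import all_classical all_reals all_analysis.

Set Implicit Arguments.
Unset Strict Implicit.
Unset Printing Implicit Defensive.

Import Order.TTheory GRing.Theory Num.Theory.

Local Open Scope ring_scope.

(* [directed G x y] is the edge x -> y, [bidirected G x y] the edge x <-> y. *)
Record mixed_graph (V : finType) := MixedGraph {
  directed : rel V;
  bidirected : rel V
}.

(* The kind of an edge, as read in the direction of travel along a path:
   x -> y, x <- y and x <-> y when moving from x to y. *)
Inductive edge_kind := Forward | Backward | Bidirected.

Definition arrow_at_source (e : edge_kind) : bool :=
  if e is Forward then false else true.

Definition arrow_at_target (e : edge_kind) : bool :=
  if e is Backward then false else true.

Section Graph.
Variables (V : finType) (G : mixed_graph V).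

Definition joined (x : V) (e : edge_kind) (y : V) : bool :=
  match e with
  | Forward => directed G x y
  | Backward => directed G y x
  | Bidirected => bidirected G x y
  end.

(* A path is given by its first vertex and the sequence of its steps; each step
   records which edge is used (there may be two between the same vertices) and
   the vertex it leads to. *)
Definition steps := seq (edge_kind * V).

Definition vertices (x : V) (s : steps) : seq V := x :: [seq t.2 | t <- s].

Fixpoint joined_along (x : V) (s : steps) : bool :=
  if s is (e, y) :: s' then joined x e y && joined_along y s' else true.

Definition is_path (a b : V) (s : steps) : bool :=
  [&& joined_along a s, uniq (vertices a s) & last a [seq t.2 | t <- s] == b].

Definition backdoor_path (a b : V) (s : steps) : bool :=
  is_path a b s && (if s is (e, _) :: _ then arrow_at_source e else false).

Definition directed_path (a b : V) (s : seq V) : bool :=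
  [&& path (directed G) a s, uniq (a :: s) & last a s == b].

Definition descendant (a b : V) : Prop := exists s, directed_path a b s.

Definition collider (s : steps) (c : V) : Prop :=
  exists s1 e f y s2, [/\ s = s1 ++ (e, c) :: (f, y) :: s2,
    arrow_at_target e & arrow_at_source f].

Definition blocks (W : {set V}) (a : V) (s : steps) : Prop :=
  (exists v, [/\ v \in W, v \in vertices a s & ~ collider s v]) \/
  (exists c, [/\ collider s c, c \notin W &
     forall d, descendant c d -> d \notin W]).

Definition blocks_backdoor (W : {set V}) (a b : V) : Prop :=
  forall s, backdoor_path a b s -> blocks W a s.

Definition opens_backdoor (W : {set V}) (a b : V) : Prop :=
  exists s, backdoor_path a b s /\ ~ blocks W a s.

Definition remove_arrows_into (W : {set V}) : mixed_graph V :=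
  MixedGraph (fun x y => directed G x y && (y \notin W))
    (fun x y => [&& bidirected G x y, x \notin W & y \notin W]).

End Graph.

Section PathCoefficients.
Variables (R : realType) (N : nat) (A : 'M[R]_N).

(* [A i j] is the coefficient of the edge from j to i. *)
Fixpoint path_product (b : 'I_N) (s : seq 'I_N) : R :=
  if s is c :: s' then A c b * path_product c s' else 1.

(* Distinctness of vertices bounds the number of steps of a path by N - 1, so
   the double sum ranges over all directed paths from b to a. *)
Definition total_effect (G : mixed_graph 'I_N) (a b : 'I_N) : R :=
  \sum_(k < N) \sum_(s : k.-tuple 'I_N | directed_path G b a s)
    path_product b s.

Definition parents (i : 'I_N) : {set 'I_N} := [set j | A i j != 0].

(* Positive definiteness of a symmetric matrix. *)
Definition positive_definite (M : 'M[R]_N) : Prop :=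
  forall v : 'cV[R]_N, v != 0 -> 0 < (v^T *m M *m v) 0 0.

End PathCoefficients.

Section Model.
Variables (d : measure_display) (Omega : measurableType d) (R : realType).
Variables (P : probability Omega R) (N : nat).
Variables (A : 'M[R]_N) (X u : 'I_N -> {RV P >-> R}).

Definition error_variance : 'M[R]_N :=
  \matrix_(i, j) fine (covariance P (u i) (u j)).

Definition causal_diagram : mixed_graph 'I_N :=
  MixedGraph (fun j i => j \in parents A i)
    (fun i j => (i != j) && (covariance P (u i) (u j) != 0%E)).

(* tau_{ab | do(W)} *)
Definition controlled_effect (a b : 'I_N) (W : {set 'I_N}) : R :=
  total_effect A (remove_arrows_into causal_diagram W) a b.

(* The random vector made of the constant 1, at index 0, and the X_k, k in S. *)
Definition regressor (S : {set 'I_N}) (l : 'I_(#|S|).+1) : Omega -> R :=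
  if unlift ord0 l is Some k then X (enum_val k) else cst 1.

Definition regression_vector (i : 'I_N) (S : {set 'I_N}) : 'cV[R]_(#|S|).+1 :=
  invmx (\matrix_(l, m) fine 'E_P[regressor l \* regressor m]%E) *m
  (\col_l fine 'E_P[@regressor S l \* X i]%E).

(* beta_{ik | Z}: the component of X_k in the regression of X_i on 1, X_k, Z. *)
Definition regression_coef (i k : 'I_N) (Z : {set 'I_N}) : R :=
  regression_vector i (k |: Z) (lift ord0 (enum_rank_in (setU11 k Z) k)) 0.

(* gamma_{ik | Z} *)
Definition bias (i k : 'I_N) (Z : {set 'I_N}) : R :=
  regression_coef i k Z - controlled_effect i k Z.

Definition opening_set (i : 'I_N) (S : {set 'I_N}) : {set 'I_N} :=
  [set k in S | `[< opens_backdoor causal_diagram (S :\ k) k i >]].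

Definition blocking_set (i : 'I_N) (S : {set 'I_N}) : {set 'I_N} :=
  [set k in S | `[< blocks_backdoor causal_diagram (S :\ k) k i >]].

End Model.

(* Main.v *)
Require Import Defs.
From HB Require Import structures.
From mathcomp Require Import all_boot all_order all_algebra ring.
From mathcomp Require Import all_classical all_reals all_analysis.

Set Implicit Arguments.
Unset Strict Implicit.
Unset Printing Implicit Defensive.

Import Order.TTheory GRing.Theory Num.Theory.
Local Open Scope ring_scope.

(** Eliminating the variables outside [S] turns the model into a smaller linear
    system X = B X + eps. Here eps = E u with E = (1 - A D)^-1, where D projects
    onto the coordinates outside [S], and B_ik, for k in [S], sums the path
    products over the directed paths from k to i that avoid [S] in between; so
    B_ik is the effect tau_{ik|do(S - k)} when i is outside [S]
    ([projected_effect], [total_effect_resolvent]). Hence X_i is the combination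
    of the X_k, k in [S], with these effects as coefficients, plus eps_i, and
    the vector gamma of all biases consists of the coefficients of the
    regression of eps_i on the X_k. Since eps = (1 - B) X, this vector is
    gamma = delta (1 - B), where delta is the vector of the coefficients of the
    regression of eps_i on the eps_k, k in [S] ([bias_decomposition]).

    The graph enters through one fact ([blocked_residual_coef]): delta_k = 0
    whenever S - k blocks every back-door path from k to i. Two residuals eps_l
    and eps_x can be correlated only if l and x are joined by a trek, that is
    by two directed paths out of one vertex or out of the two ends of a
    bidirected edge, whose vertices before l and x lie outside [S]
    ([reaches_trek]). Joining treks end to end gives walks whose colliders are
    in [S] and whose other inner vertices are not. Let K be the set of the
    vertices of [S] that such walks reach from k. No residual of K is correlated
    with a residual of the rest of [S]; if none is correlated with eps_i either,
    then delta vanishes on K, which contains k ([regression_vanish]). Otherwise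
    a walk reaches i, and a shortest one is a back-door path that S - k opens
    ([open_walk_uniq], [reaches_opens]).

    So delta vanishes on [S2]. Let M = (1 - D' A)^-1, where D' projects onto the
    coordinates outside [S2]; its entries M_pj are the effects
    tau_{pj|do(S2 - j)} for j in [S2]. By [projected_system] 1 - B = E (1 - A),
    so that gamma M = delta E (1 - A) M. The columns of (1 - A) M in [S2] are
    supported on [S2]. The nonempty paths counted by E start outside [S], so
    delta E has the same entries on [S2] as delta, namely 0. Therefore gamma M
    vanishes on [S2] ([bias_orthogonal]). As M agrees with the identity
    on the rows of [S2], entry j of gamma M is gamma_j plus the sum over [S1] of
    gamma_p tau_{pj|do(S2 - j)}. *)

(** * Coordinate projections and resolvents *)

Lemma sum_neq0 (I : finType) (V : nmodType) (F : I -> V) :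
  \sum_i F i != 0 -> exists i, F i != 0.
Proof.
move=> F0; apply/existsP; apply: contraNT F0; rewrite negb_exists => /forallP
  F0.
by rewrite big1 // => i _; apply/eqP; have := F0 i; rewrite negbK.
Qed.

Section Projectors.
Variables (R : realFieldType) (N : nat).
Implicit Types (A : 'M[R]_N) (S K : {set 'I_N}).

Definition coord_proj S : 'M[R]_N := diag_mx (\row_k (k \in S)%:R).

Lemma mulmx_coord_proj m (M : 'M[R]_(m, N)) S a b :
  (M *m coord_proj S) a b = M a b * (b \in S)%:R.
Proof. by rewrite mul_mx_diag !mxE. Qed.

Lemma coord_proj_mulmx m (M : 'M[R]_(N, m)) S a b :
  (coord_proj S *m M) a b = (a \in S)%:R * M a b.
Proof. by rewrite mul_diag_mx !mxE. Qed.

Lemma coord_proj_setC S : coord_proj (~: S) = 1%:M - coord_proj S.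
Proof.
apply/matrixP => a b; rewrite !mxE finset.in_setC -mulrnBl; congr (_ *+ _).
by case: (a \in S); rewrite ?subrr ?subr0.
Qed.

Lemma coord_projM S K : coord_proj S *m coord_proj K = coord_proj (S :&: K).
Proof.
apply/matrixP => a b; rewrite mulmx_coord_proj !mxE inE.
case: eqVneq => [->|_]; last by rewrite !mulr0n mul0r.
by rewrite !mulr1n -natrM mulnb.
Qed.

Lemma coord_proj_disjoint S K : S \subset ~: K -> coord_proj S *m coord_proj K
  = 0.
Proof.
rewrite coord_projM => /fintype.subsetP SK; apply/matrixP => a b; rewrite !mxE
  inE.
case aS: (a \in S); last by rewrite mul0rn.
by move: (SK _ aS); rewrite inE => /negbTE ->; rewrite mul0rn.
Qed.

Lemma mul_coord_proj_eq0 (v : 'rV[R]_N) S :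
  (forall k, k \in S -> v 0 k = 0) -> v *m coord_proj S = 0.
Proof.
move=> vS; apply/rowP => k; rewrite mulmx_coord_proj mxE.
by case: (boolP (k \in S)) => [/vS ->|_]; rewrite ?mul0r ?mulr0.
Qed.

Definition strictly_lower A := forall a b : 'I_N, A a b != 0 -> (b < a)%N.

Lemma strictly_lower_mulmx_coord_proj A S :
  strictly_lower A -> strictly_lower (A *m coord_proj S).
Proof.
by move=> lA a b; rewrite mulmx_coord_proj mulf_eq0 negb_or => /andP[/lA].
Qed.

Lemma strictly_lower_coord_proj_mulmx A S :
  strictly_lower A -> strictly_lower (coord_proj S *m A).
Proof.
by move=> lA a b; rewrite coord_proj_mulmx mulf_eq0 negb_or => /andP[_ /lA].
Qed.

Lemma strictly_lower_unit A : strictly_lower A -> 1%:M - A \in unitmx.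
Proof.
move=> lA; have A0 (a b : 'I_N) : (a <= b)%N -> A a b = 0.
  by apply: contraTeq => /lA; rewrite ltnNge.
rewrite unitmxE det_trig; last first.
  apply/is_trig_mxP => a b ab; rewrite !mxE (A0 _ _ (ltnW ab)) subr0.
  by rewrite eq_sym -val_eqE gtn_eqF.
by rewrite big1 ?unitr1 // => a _; rewrite !mxE eqxx A0 // subr0.
Qed.

(** For the coefficient matrix of an acyclic graph this is the sum of all the
    powers of [A]: entry (a, b) sums the path products over the directed paths
    from b to a, the empty path included. *)
Definition resolvent A := invmx (1%:M - A).

Section Resolvent.
Variable A : 'M[R]_N.
Hypothesis lA : strictly_lower A.

Lemma mul_resolvent : (1%:M - A) *m resolvent A = 1%:M.
Proof. by rewrite mulmxV // strictly_lower_unit. Qed.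

Lemma resolvent_mul : resolvent A *m (1%:M - A) = 1%:M.
Proof. by rewrite mulVmx // strictly_lower_unit. Qed.

Lemma resolventEl : resolvent A = 1%:M + A *m resolvent A.
Proof. by rewrite -[X in X + _]mul_resolvent mulmxBl mul1mx subrK. Qed.

Lemma resolventEr : resolvent A = 1%:M + resolvent A *m A.
Proof. by rewrite -[X in X + _]resolvent_mul mulmxBr mulmx1 subrK. Qed.

Lemma resolvent_unit : resolvent A \in unitmx.
Proof. by rewrite unitmx_inv strictly_lower_unit. Qed.

End Resolvent.

(** With the columns outside [S] erased, a path may leave a vertex only if this
    vertex is in [S]; the two lemmas peel off the last and the first edge of
    such a path. *)
Lemma resolvent_supportl A S (x m : 'I_N) : strictly_lower A ->
    resolvent (A *m coord_proj S) x m != 0 ->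
  x = m \/ exists q, [/\ q \in S, A x q != 0 & resolvent (A *m coord_proj S) q
    m != 0].
Proof.
move=> lA; rewrite {1}(resolventEl (strictly_lower_mulmx_coord_proj lA)) !mxE.
have [->|xm] := eqVneq x m; first by left.
rewrite add0r => /sum_neq0[q]; rewrite mulmx_coord_proj !mulf_eq0 !negb_or =>
  /andP[/andP[Axq qS] Eq].
by right; exists q; split=> //; move: qS; case: (q \in S) => //; rewrite eqxx.
Qed.

Lemma resolvent_supportr A S (x m : 'I_N) : strictly_lower A ->
    resolvent (A *m coord_proj S) x m != 0 ->
  x = m \/ m \in S /\ exists q, resolvent (A *m coord_proj S) x q != 0 /\ A q m
    != 0.
Proof.
move=> lA; rewrite {1}(resolventEr (strictly_lower_mulmx_coord_proj lA)) !mxE.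
have [->|xm] := eqVneq x m; first by left.
rewrite add0r => /sum_neq0[q]; rewrite mulmx_coord_proj !mulf_eq0 !negb_or =>
  /andP[Exq /andP[Aqm mS]].
right; split; last by exists q.
by move: mS; case: (m \in S) => //; rewrite eqxx.
Qed.

(** * Positive definite matrices and regression *)

Lemma posdef_congr (M E : 'M[R]_N) :
    (forall v : 'rV_N, v != 0 -> 0 < (v *m M *m v^T) 0 0) -> E \in unitmx ->
  forall v : 'rV_N, v != 0 -> 0 < (v *m (E *m M *m E^T) *m v^T) 0 0.
Proof.
move=> pM uE v v0; rewrite !mulmxA -mulmxA -trmx_mul; apply: pM.
by apply: contra_neq v0 => vE; rewrite -[v](mulmxK uE) vE mul0mx.
Qed.

(** Read [M] as a covariance matrix and [v] as the coefficients of the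
    regression of variable [i] on the variables in [S]. The block [K] is
    uncorrelated both with the rest of [S] and with [i], so the restriction of
    [v] to [K] solves a homogeneous system with a positive definite matrix. *)
Lemma regression_vanish (M : 'M[R]_N) S K (i : 'I_N) (v : 'rV[R]_N) :
    (forall v : 'rV_N, v != 0 -> 0 < (v *m M *m v^T) 0 0) ->
    v *m coord_proj (~: S) = 0 -> (delta_mx 0 i - v) *m M *m coord_proj S = 0 ->
    K \subset S ->
    (forall x, x \in K -> M i x = 0) ->
    (forall l x, l \in S -> l \notin K -> x \in K -> M l x = 0) ->
  v *m coord_proj K = 0.
Proof.
move=> pM vS vM /fintype.subsetP KS Mi Ml; apply: contraTeq isT => /pM; rewrite
  mxE.
rewrite big1 ?ltxx // => x _; rewrite [_^T _ _]mxE mulmx_coord_proj.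
case: (boolP (x \in K)) => [xK|_]; last by rewrite !mulr0.
have -> : (v *m coord_proj K *m M) 0 x = (v *m M) 0 x.
  rewrite !mxE; apply: eq_bigr => l _; rewrite mulmx_coord_proj.
  case: (boolP (l \in K)) => [_|lK]; first by rewrite mulr1.
  have [lS|lS] := boolP (l \in S); first by rewrite Ml ?mulr0.
  have /rowP/(_ l) := vS; rewrite mulmx_coord_proj finset.in_setC lS mulr1 mxE
    => ->.
  by rewrite !mul0r.
have /rowP/(_ x) := vM; rewrite mulmx_coord_proj KS // mulr1 mulmxBl -rowE !mxE
  Mi //.
by move/eqP; rewrite sub0r oppr_eq0 => /eqP->; rewrite !mul0r.
Qed.

(** * Elimination of the variables outside a set *)

Section Bias.
Variables (A Sigma : 'M[R]_N) (S : {set 'I_N}).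
Hypothesis lA : strictly_lower A.
Let L := resolvent A.
Let E := resolvent (A *m coord_proj (~: S)).
Let B := E *m A *m coord_proj S.

Let lAS : strictly_lower (A *m coord_proj (~: S)).
Proof. exact: strictly_lower_mulmx_coord_proj. Qed.

(** In terms of variables: multiplying X = A X + u by [E] eliminates the
    variables outside [S] from the right-hand sides and leaves
    (1 - B) X = E u. *)
Lemma projected_system : E *m (1%:M - A) = 1%:M - B.
Proof.
rewrite -[1%:M in RHS](resolvent_mul lAS) -/E /B -mulmxA -mulmxBr.
congr (_ *m _); rewrite coord_proj_setC mulmxBr mulmx1 opprB -addrA [_ - A +
  _]addrAC.
by rewrite subrr add0r.
Qed.

(** [B] cuts the edges leaving [S] except at the start of the path, while the
    right-hand side cuts the edges entering [S]. Between a start in [S] and an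
    end outside it both select the paths that avoid [S] in between; in algebra,
    this is the identity (1 - A D)^-1 A = A (1 - D A)^-1. *)
Lemma projected_effect i k : i \notin S -> k \in S ->
  B i k = resolvent (coord_proj (~: S) *m A) i k.
Proof.
move=> iS kS; have ik : i != k by apply: contraNneq iS => ->.
have lSA : strictly_lower (coord_proj (~: S) *m A).
  exact: strictly_lower_coord_proj_mulmx.
have EA : E *m A = A *m resolvent (coord_proj (~: S) *m A).
  rewrite -[A in LHS]mulmx1 -(mul_resolvent lSA) !mulmxA; congr (_ *m _).
  rewrite mulmxBr mulmx1 -[RHS]mul1mx -(resolvent_mul lAS) -/E -[RHS]mulmxA.
  by rewrite mulmxBl mul1mx mulmxBr !mulmxA.
rewrite /B mulmx_coord_proj kS mulr1 EA [in RHS](resolventEl lSA) [RHS]mxE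
  -mulmxA.
by rewrite coord_proj_mulmx finset.in_setC iS mul1r [1%:M _ _]mxE (negbTE ik)
  add0r.
Qed.

(** [beta] is characterized as the regression row of X_i on the X_k, k in [S]:
    it is supported on [S] and its residual is uncorrelated with them. The
    passage from the X_k to the residuals E u is a change of basis inside [S],
    so the same residual X_i - beta X, rewritten as (e_i - delta) E u, is that
    of the regression of the i-th entry of E u on its entries in [S]. *)
Lemma bias_decomposition (i : 'I_N) (beta : 'rV[R]_N) :
    beta *m coord_proj (~: S) = 0 ->
    (delta_mx 0 i - beta) *m (L *m Sigma *m L^T) *m coord_proj S = 0 ->
  exists delta : 'rV[R]_N,
  [/\ delta *m coord_proj (~: S) = 0,
      (delta_mx 0 i - delta) *m (E *m Sigma *m E^T) *m coord_proj S = 0 &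
      beta - row i B = delta *m E *m (1%:M - A)].
Proof.
(* Y is the inverse of 1 - B, so that X = Y E u. *)
move=> bS bC; pose Y := L *m (1%:M - A *m coord_proj (~: S)).
have YE : Y *m E = L by rewrite /Y -mulmxA mul_resolvent // mulmx1.
have YB : Y *m (E *m (1%:M - A)) = 1%:M by rewrite mulmxA YE resolvent_mul.
have YS : Y *m coord_proj (~: S) = coord_proj (~: S).
  rewrite /Y mulmxBr mulmx1 mulmxBl -!mulmxA coord_projM finset.setIid mulmxA
    -mulmxBl.
  by rewrite -[X in X - _]mulmx1 -mulmxBr resolvent_mul // mul1mx.
clearbody Y; exists (delta_mx 0 i - (delta_mx 0 i - beta) *m Y); split.
- by rewrite mulmxBl -mulmxA YS mulmxBl bS subr0 subrr.
- rewrite opprB addrC subrK.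
  (* On the rows of S, E is L up to a matrix acting within S. *)
  have ES : coord_proj S *m E = coord_proj S *m (E *m (1%:M - A)) *m coord_proj
    S *m L.
    have -> : coord_proj S *m E = coord_proj S *m (E *m (1%:M - A)) *m L.
      by rewrite -!mulmxA mul_resolvent // mulmx1.
    congr (_ *m _); rewrite projected_system mulmxBr mulmx1 mulmxBl coord_projM.
    by rewrite finset.setIid /B -!mulmxA coord_projM finset.setIid.
  have -> : (delta_mx 0 i - beta) *m Y *m (E *m Sigma *m E^T) *m coord_proj S =
      (delta_mx 0 i - beta) *m (L *m Sigma) *m (coord_proj S *m E)^T.
    by rewrite trmx_mul tr_diag_mx !mulmxA -[_ *m Y *m E]mulmxA YE.
  rewrite ES !trmx_mul tr_diag_mx !mulmxA.
  by move: bC; rewrite !mulmxA => ->; rewrite !mul0mx.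
rewrite -[RHS]mulmxA mulmxBl -mulmxA YB mulmx1 projected_system.
by rewrite mulmxBr mulmx1 -rowE opprB [RHS]addrC addrA subrK.
Qed.

(** Let M be the resolvent in the statement. Since 1 - A is 1 - D' A minus the
    rows of [A] in [K], where D' projects outside [K], the product
    (1 - A) M differs from 1 only in the rows of [K]; and [delta] times [E]
    vanishes on [K] because [E] is the identity on the columns of [S]. *)
Lemma bias_orthogonal (K : {set 'I_N}) (delta : 'rV[R]_N) :
    K \subset S -> delta *m coord_proj K = 0 ->
  delta *m E *m (1%:M - A) *m resolvent (coord_proj (~: K) *m A) *m coord_proj
    K = 0.
Proof.
move=> KS dK; have lKA : strictly_lower (coord_proj (~: K) *m A).
  exact: strictly_lower_coord_proj_mulmx.
have EK : delta *m E *m coord_proj K = 0.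
  rewrite /E resolventEr // -/E mulmxDr mulmx1 mulmxDl dK add0r.
  rewrite -!mulmxA [coord_proj (~: S) *m _]coord_proj_disjoint ?finset.setCS //.
  by rewrite !mulmx0.
have -> : 1%:M - A = 1%:M - coord_proj (~: K) *m A - coord_proj K *m A.
  by rewrite coord_proj_setC mulmxBl mul1mx -[RHS]addrA -opprD subrK.
rewrite mulmxBr mulmxBl -[_ *m E *m _ *m _]mulmxA mul_resolvent // mulmx1.
by rewrite mulmxBl EK [_ *m E *m _]mulmxA EK !mul0mx subrr.
Qed.

End Bias.
End Projectors.

(** * Total effects as entries of a resolvent *)

Section PathSums.
Variables (R : realType) (N : nat) (A : 'M[R]_N) (G : mixed_graph 'I_N).
Hypothesis lA : strictly_lower A.
Hypothesis GA : forall x y, directed G x y = (A y x != 0).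

(** Erasing the rows of [W] in [A] makes the product of any sequence that is
    not a path of the mutilated graph vanish, so that sums over paths become
    sums over all sequences. *)
Lemma path_product_restrict W (b : 'I_N) s :
  path_product (coord_proj R (~: W) *m A) b s =
  if path (directed (remove_arrows_into G W)) b s then path_product A b s else
    0.
Proof.
elim: s b => //= c s IHs b; rewrite IHs coord_proj_mulmx finset.in_setC GA.
have [->|_] /= := eqVneq (A c b) 0; first by rewrite mulr0 mul0r.
by case: (c \in W); rewrite /= ?mul0r ?mul1r //; case: ifP; rewrite ?mulr0.
Qed.

(** Indices increase along the edges, so walks never repeat a vertex. *)
Lemma directed_path_uniq W (a b : 'I_N) s :
  directed_path (remove_arrows_into G W) b a s =
  path (directed (remove_arrows_into G W)) b s && (last b s == a).
Proof.
rewrite /directed_path; case pth: path => //=.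
suff -> : (b \notin s) && uniq s by [].
apply: (@sorted_uniq _ (fun x y : 'I_N => x < y)%N _ _ (b :: s)).
- exact: ltn_trans.
- by move=> x; exact: ltnn.
by apply: sub_path pth => x y /= /andP[]; rewrite GA => /lA.
Qed.

(** A path with distinct vertices never comes back to its source, so the edges
    into the source may be removed as well. *)
Lemma directed_path_source W (a b : 'I_N) s :
  directed_path (remove_arrows_into G (W :\ b)) b a s =
  directed_path (remove_arrows_into G W) b a s.
Proof.
rewrite /directed_path [uniq _]/= -/(uniq s).
case bs: (b \in s); first by rewrite !andbF.
congr (_ && _); elim: s {3 4}b bs => //= c s IHs x.
rewrite inE => /negbT /norP[bc bs]; rewrite IHs ?(negbTE bs) //.
by rewrite !inE eq_sym bc.
Qed.

(** The [n]-th power of [B], in the form in which it appears in a total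
    effect. *)
Definition walk_sum (B : 'M[R]_N) n : 'M[R]_N :=
  \matrix_(a, b) \sum_(s : n.-tuple 'I_N | last b s == a) path_product B b s.

Lemma walk_sum0 B : walk_sum B 0 = 1%:M.
Proof.
apply/matrixP => a b; rewrite !mxE big_mkcond /=.
rewrite (big_pred1 [tuple]) => [|s]; last exact/esym/eqP/tuple0.
by rewrite /= eq_sym; case: eqP.
Qed.

Lemma walk_sumS B n : walk_sum B n.+1 = walk_sum B n *m B.
Proof.
apply/matrixP => a b; rewrite !mxE.
rewrite (reindex (fun p : 'I_N * n.-tuple 'I_N => [tuple of p.1 :: p.2])) /=;
  last first.
  exists (fun t : n.+1.-tuple 'I_N => (thead t, [tuple of behead t])).
    by move=> [c s] _; rewrite theadE; congr (_, _); apply/val_inj.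
  by move=> t _; rewrite /= -tuple_eta.
rewrite -(pair_big_dep xpredT (fun c (s : n.-tuple 'I_N) => last c s == a)
  (fun c (s : n.-tuple 'I_N) => B c b * path_product B c s)) /=.
by apply: eq_bigr => c _; rewrite mxE mulr_suml; apply: eq_bigr => s _; rewrite
  mulrC.
Qed.

Lemma walk_sum_support (B : 'M[R]_N) n (a b : 'I_N) : strictly_lower B ->
  walk_sum B n a b != 0 -> (b + n <= a)%N.
Proof.
move=> lB; elim: n b => [|n IHn] b.
  by rewrite walk_sum0 mxE addn0; case: (eqVneq a b) => [->//|_]; rewrite eqxx.
rewrite walk_sumS mxE => /sum_neq0[c].
rewrite mulf_eq0 negb_or => /andP[/IHn ca /lB bc].
by rewrite (leq_trans _ ca) // addnS ltn_add2r.
Qed.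

(** The geometric sum telescopes against 1 - B, and its remainder is the [N]-th
    power, which vanishes because indices increase by at least one per step. *)
Lemma walk_sum_resolvent (B : 'M[R]_N) : strictly_lower B ->
  \sum_(n < N) walk_sum B n = resolvent B.
Proof.
move=> lB; rewrite -[LHS]mulmx1 -(mul_resolvent lB) mulmxA; set X := _ *m (_ -
  _).
suff -> : X = 1%:M by rewrite mul1mx.
rewrite {}/X mulmxBr mulmx1 mulmx_suml.
have -> : \sum_(n < N) walk_sum B n *m B = \sum_(n < N) walk_sum B n.+1.
  by apply: eq_bigr => n _; rewrite walk_sumS.
rewrite -sumrB (eq_bigr (fun n : 'I_N => - (walk_sum B n.+1 - walk_sum B n))).
  rewrite sumrN -(big_mkord xpredT (fun n => walk_sum B n.+1 - walk_sum B n)).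
  rewrite telescope_sumr // opprB walk_sum0.
  suff -> : walk_sum B N = 0 by rewrite subr0.
  apply/matrixP => a b; rewrite [RHS]mxE; apply: contraTeq isT =>
    /walk_sum_support.
  by move=> /(_ lB); rewrite leqNgt (leq_trans (ltn_ord a)) // leq_addl.
by move=> n _; rewrite opprB.
Qed.

Lemma total_effect_resolvent W a b :
  total_effect A (remove_arrows_into G (W :\ b)) a b =
  resolvent (coord_proj R (~: W) *m A) a b.
Proof.
rewrite -walk_sum_resolvent; last exact: strictly_lower_coord_proj_mulmx.
rewrite summxE; apply: eq_bigr => n _; rewrite mxE.
rewrite big_mkcond [RHS]big_mkcond; apply: eq_bigr => s _ /=.
rewrite directed_path_source directed_path_uniq path_product_restrict.
by case: path; case: (last b s == a).
Qed.

End PathSums.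

(** * Open walks and open back-door paths *)

Section OpenWalks.
Variables (V : finType) (G : mixed_graph V) (S : {set V}) (k : V).
Hypothesis kS : k \in S.

(** Counting [k] itself makes the start of a walk an ordinary
    vertex, see [open_walk]. *)
Definition may_collide (x : V) : bool :=
  (x == k) || [exists w in S :\ k, connect (directed G) x w].

(** Whether a walk may pass through [x] with arrowheads at [x] on the incoming
    and the outgoing edge as told by [a] and [b]. *)
Definition passable (x : V) (a b : bool) : bool :=
  if a && b then may_collide x else x \notin S.

Fixpoint open_from (a : bool) (x : V) (s : steps V) : bool :=
  if s is (e, y) :: s' then
    [&& passable x a (arrow_at_source e), joined G x e y
      & open_from (arrow_at_target e) y s']
  else true.

(** The walk starts at [k] as if it had arrived there with an arrowhead. As [k]
    is in [S], it can then only be left as a collider, so the first edge points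
    into [k] and the walk is of back-door type. *)
Definition open_walk (s : steps V) (y : V) : bool :=
  [&& open_from true k s, k \notin [seq t.2 | t <- s]
    & last k [seq t.2 | t <- s] == y].

Definition reaches (y : V) (a : bool) : Prop :=
  exists s, open_walk s y /\ last true [seq arrow_at_target t.1 | t <- s] = a.

Lemma open_from_rcons a x s e y :
  open_from a x (rcons s (e, y)) =
  [&& open_from a x s,
      passable (last x [seq t.2 | t <- s])
        (last a [seq arrow_at_target t.1 | t <- s]) (arrow_at_source e)
    & joined G (last x [seq t.2 | t <- s]) e y].
Proof.
elim: s a x => [|[f z] s IHs] a x /=; first by rewrite andbT.
by rewrite IHs -!andbA.
Qed.

Lemma open_from_cat a x s1 e v s2 :
  open_from a x (s1 ++ (e, v) :: s2) =
  open_from a x (rcons s1 (e, v)) && open_from (arrow_at_target e) v s2.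
Proof.
elim: s1 a x => [|[f z] s IHs] a x /=; first by rewrite andbT -andbA.
by rewrite IHs -!andbA.
Qed.

Lemma reaches_source : reaches k true.
Proof. by exists [::]; split=> //; rewrite /open_walk /= eqxx. Qed.

Lemma reaches_step x a e y : reaches x a -> passable x a (arrow_at_source e) ->
  joined G x e y -> y != k -> reaches y (arrow_at_target e).
Proof.
move=> [s [/and3P[ os ks /eqP ls] la]] pas jxy yk.
exists (rcons s (e, y)); split; last by rewrite map_rcons last_rcons.
rewrite /open_walk open_from_rcons ls la os pas jxy map_rcons last_rcons eqxx.
by rewrite mem_rcons inE negb_or eq_sym yk ks.
Qed.

Lemma may_collide_parent x y :
  directed G x y -> y != k -> may_collide y -> may_collide x.
Proof.
move=> xy /negbTE yk; rewrite /may_collide yk /= => /existsP[w /andP[wS yw]].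
apply/orP; right; apply/existsP; exists w; rewrite wS.
exact: connect_trans (connect1 xy) yw.
Qed.

(** A walk that comes into [x] with an arrowhead and ends with an edge traversed
    backward must turn round: either [x] is a collider, or the walk leaves [x]
    forward and keeps descending until its first collider, which is a
    descendant of [x]. *)
Lemma may_collide_loop x s e y : k \notin [seq t.2 | t <- s] -> y != k ->
    arrow_at_target e = false ->
  open_from true x (rcons s (e, y)) -> may_collide x.
Proof.
move=> + yk te; elim: s x => [|[f z] s IHs] x /=.
  by case: e te => //= _ _ /andP[].
rewrite inE negb_or => /andP[kz ks] /and3P[].
case: f => //= _ xz os; apply: may_collide_parent xz _ (IHs _ ks os).
by rewrite eq_sym.
Qed.

(** Cutting out a loop at [v] combines the first incoming edge with the last
    outgoing one. The only delicate case is when [v] becomes a collider without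
    having been one at either visit: then the loop leaves [v] forward and comes
    back to it backward, and [may_collide_loop] applies. *)
Lemma open_from_cut e v s2 f s3 :
    v != k -> k \notin [seq t.2 | t <- s2] ->
  open_from (arrow_at_target e) v (s2 ++ (f, v) :: s3) ->
  open_from (arrow_at_target e) v s3.
Proof.
move=> vk ks2; rewrite open_from_cat => /andP[ o2].
case: s3 => [|[g y] s3] //= /and3P[p2 jy ->]; rewrite jy !andbT.
move: p2 o2; rewrite /passable.
case te: (arrow_at_target e); case sg: (arrow_at_source g);
  case tf: (arrow_at_target f) => //=.
  by move=> _; apply: may_collide_loop.
case: s2 ks2 => [|[h z] s2] _ /=; by rewrite /passable /= => _ /andP[].
Qed.

Lemma visited_split (s : steps V) (y : V) : y \in [seq t.2 | t <- s] ->
  exists s1 e s2, s = s1 ++ (e, y) :: s2.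
Proof.
elim: s => // -[e z] s IHs /=; rewrite inE => /predU1P[->|/IHs].
  by exists [::], e, s.
by case=> s1 [f [s2 ->]]; exists ((e, z) :: s1), f, s2.
Qed.

Lemma repeated_vertex (s : steps V) : ~~ uniq [seq t.2 | t <- s] ->
  exists s1 e v s2 f s3, s = s1 ++ (e, v) :: s2 ++ (f, v) :: s3.
Proof.
elim: s => // -[e v] s IHs /=; rewrite negb_and negbK.
case/orP=> [/visited_split[s2 [f [s3 ->]]]|].
  by exists [::], e, v, s2, f, s3.
case/IHs=> s1 [f [w [s2 [g [s3 ->]]]]].
by exists ((e, v) :: s1), f, w, s2, g, s3.
Qed.

Lemma open_walk_uniq s y : open_walk s y ->
  exists2 s', open_walk s' y & uniq [seq t.2 | t <- s'].
Proof.
have [n] := ubnP (size s); elim: n s => // n IHn s; rewrite ltnS => sz os.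
have [us|/repeated_vertex[s1 [e [v [s2 [f [s3 Es]]]]]]] :=
  boolP (uniq [seq t.2 | t <- s]); first by exists s.
rewrite {}Es in sz os; apply: (IHn (s1 ++ (e, v) :: s3)).
  apply: leq_trans sz; rewrite !size_cat /= size_cat /= ltn_add2l !ltnS.
  exact: leq_addl.
move: os; rewrite /open_walk open_from_cat !map_cat /= map_cat /=.
rewrite !(mem_cat, inE) !last_cat /= last_cat /= !negb_or.
case/and3P=> /andP[ o1 o2] /and5P[k1 kv k2 _ k3] l3.
rewrite open_from_cat o1 k1 kv k3 l3 /= andbT.
by apply: open_from_cut o2 => //; rewrite eq_sym.
Qed.

Lemma open_from_joined a x s : open_from a x s -> joined_along G x s.
Proof. by elim: s a x => [|[e y] s IHs] a x //= /and3P[_ -> /IHs]. Qed.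

Lemma connect_descendant x y : connect (directed G) x y -> descendant G x y.
Proof.
case/connectP=> p pp ->; case/shortenP: pp => q pq uq _.
by exists q; rewrite /directed_path pq uq eqxx.
Qed.

(** On a walk with distinct vertices, passability at every inner vertex is the
    negation of both clauses of [blocks]. *)
Lemma reaches_opens i a : i \notin S -> reaches i a ->
  opens_backdoor G (S :\ k) k i.
Proof.
move=> iS [s0 [/open_walk_uniq[s /and3P[ os ks /eqP ls] us] _]].
have ki : k != i by apply: contraNneq iS => <-.
exists s; split.
  rewrite /backdoor_path /is_path (open_from_joined os) /vertices /= ks us ls.
  rewrite eqxx /=; case: s os {ks us} ls => [_ /= /eqP|[e y] s /=].
    by rewrite (negbTE ki).
  by rewrite /passable /= kS; case: (arrow_at_source e).
case=> [[v [vW vs ncol]]|[c [[s1 [e [f [y [s2 [Es te sf]]]]]] cW dW]]].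
- have [vk vS] : v != k /\ v \in S by move: vW; rewrite !inE => /andP[].
  move: vs; rewrite inE (negbTE vk) /= => /visited_split[s1 [e [s2 Es]]].
  move: os ls; rewrite {}Es in ncol *; case: s2 ncol => [|[f y] s2] ncol.
    by rewrite map_cat last_cat /= => _ vi; rewrite -vi vS in iS.
  rewrite open_from_cat => /andP[_ /= /and3P[pv _ _]] _.
  apply: ncol; exists s1, e, f, y, s2; move: pv; rewrite /passable vS.
  by case: (arrow_at_target e); case: (arrow_at_source f).
- move: os ks; rewrite Es open_from_cat map_cat mem_cat inE !negb_or.
  move=> /andP[_ /= /and3P[+ _ _]] /and3P[_ kc _].
  rewrite /passable te sf /= /may_collide eq_sym (negbTE kc) /=.
  case/existsP=> w /andP[wW /connect_descendant/dW].
  by rewrite wW.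
Qed.

End OpenWalks.

(** * Treks between correlated residuals *)

Section Treks.
Variables (R : realType) (N : nat) (A Sigma : 'M[R]_N) (G : mixed_graph 'I_N).
Hypothesis lA : strictly_lower A.
Hypothesis GA : forall x y, directed G x y = (A y x != 0).
Hypothesis GSigma : forall x y, x != y -> Sigma x y != 0 -> bidirected G y x.
Variables (S : {set 'I_N}) (k : 'I_N).
Hypothesis kS : k \in S.
Let E := resolvent (A *m coord_proj R (~: S)).

(** A nonzero covariance of the residuals of [x] and [l] exhibits directed paths
    from some [m] to [l] and from some [m'] to [x], left through vertices
    outside [S], with [m = m'] or a bidirected edge between them. The walk
    reaching [l] extends along the first path backward, then across, then along
    the second path forward. *)
Lemma reaches_trek l x :
    l \in S -> reaches G S k l true -> x != k ->
    (E *m Sigma *m E^T) x l != 0 ->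
  exists a, reaches G S k x a /\ (x \in S -> a).
Proof.
move=> lS rl xk; rewrite mxE => /sum_neq0[m].
rewrite [E^T _ _]mxE mulf_eq0 negb_or mxE => /andP[/sum_neq0[m'] + Elm].
rewrite mulf_eq0 negb_or => /andP[Exm' Sm].
have notk y : y \in ~: S -> y != k.
  by rewrite finset.in_setC; apply: contraNneq => ->.
(* Backward along the first path. The state at m allows leaving m along an edge
   with an arrowhead at m. *)
have [a [rm am]] : exists a, reaches G S k m a /\ passable G S k m a true.
  have [n] := ubnP (N - m); elim: n m Elm {Sm} => // n IHn m Elm mn.
  have [<-|[mT [q [Elq Aqm]]]] := resolvent_supportr lA Elm.
    exists true; split=> //; rewrite /passable /= /may_collide.
    have [//|lk] /= := eqVneq l k; apply/existsP; exists l.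
    by rewrite !inE lk lS connect0.
  have [|a [rq pq]] := IHn q Elq.
    rewrite -ltnS (leq_trans _ mn) // ltnS ltn_sub2l //.
    exact: lA Aqm.
  exists false; split; last by rewrite finset.in_setC in mT.
  apply: (reaches_step (e := Backward) rq pq); last exact: notk.
  by rewrite /= GA.
have m'k : m' != k.
  by have [<-//|[/notk]] := resolvent_supportr lA Exm'.
(* Across from m to m'. *)
have {m am rm Sm Elm} [b [rm' bm']] :
    exists b, reaches G S k m' b /\ (m' \in S -> b).
  have [->|mm'] := eqVneq m' m.
    by exists a; split=> // mS; move: am; rewrite /passable mS; case: (a).
  exists true; split=> //.
  by apply: (reaches_step (e := Bidirected) rm am) => //; apply: GSigma.
(* Forward along the second path. *)
have [n] := ubnP (x : nat).
elim: n x xk Exm' => // n IHn x xk Exm'; rewrite ltnS => xn.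
have [->|[q [qT Axq Eqm']]] := resolvent_supportl lA Exm'; first by exists b.
have [||c [rq _]] := IHn q _ Eqm'; first exact: notk.
  exact: leq_trans (lA Axq) xn.
exists true; split=> //.
apply: (reaches_step (e := Forward) rq) => //; last by rewrite /= GA.
by rewrite /passable andbF -finset.in_setC.
Qed.

End Treks.

(** * Normal equations with an intercept *)

Lemma unitmx_row_kernel (F : fieldType) n (M : 'M[F]_n) :
  (forall v : 'rV_n, v *m M = 0 -> v = 0) -> M \in unitmx.
Proof.
move=> kM; rewrite -row_free_unit -kermx_eq0; apply/eqP/row_matrixP => r.
by rewrite row0; apply: kM; rewrite -row_mul mulmx_ker row0.
Qed.

Section NormalEquations.
Variables (R : realFieldType) (N : nat) (S : {set 'I_N}).

(** A family indexed by the positions in the enumeration of [S], as a row vector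
    indexed by all the vertices. *)
Definition extend_by_zero (f : 'I_#|S| -> R) : 'rV[R]_N :=
  \row_m \sum_k f k * (enum_val k == m)%:R.

Lemma extend_enum_val f k : extend_by_zero f 0 (enum_val k) = f k.
Proof.
rewrite mxE (bigD1 k) //= eqxx mulr1 big1 ?addr0 // => l lk.
by rewrite (inj_eq enum_val_inj) (negbTE lk) mulr0.
Qed.

Lemma extend_out f m : m \notin S -> extend_by_zero f 0 m = 0.
Proof.
move=> mS; rewrite mxE big1 // => k _; case: eqP => [km|]; last by rewrite
  mulr0.
by rewrite -km enum_valP in mS.
Qed.

Lemma extend_mulmx f (M : 'M[R]_N) m :
  (extend_by_zero f *m M) 0 m = \sum_k f k * M (enum_val k) m.
Proof.
rewrite mxE (bigID (mem S)) /= [X in _ + X]big1 ?addr0 => [|l lS]; last first.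
  by rewrite extend_out ?mul0r.
rewrite big_enum_val; apply: eq_bigr => k _.
by rewrite extend_enum_val.
Qed.

Variables (C : 'M[R]_N) (xi : 'I_N -> R).
Hypothesis posC : forall v : 'rV[R]_N, v != 0 -> 0 < (v *m C *m v^T) 0 0.
Hypothesis symC : C^T = C.
Variable (M : 'M[R]_(#|S|.+1)).
Hypothesis M00 : M ord0 ord0 = 1.
Hypothesis M0k : forall k, M ord0 (lift ord0 k) = xi (enum_val k).
Hypothesis Mk0 : forall k, M (lift ord0 k) ord0 = xi (enum_val k).
Hypothesis Mkl : forall k l, M (lift ord0 k) (lift ord0 l) =
  C (enum_val k) (enum_val l) + xi (enum_val k) * xi (enum_val l).

(** [M] is the matrix of second moments of the constant 1 and of variables with
    means [xi] and covariances [C]. The column of the constant expresses the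
    intercept through the other coefficients; substituting it turns second
    moments into covariances, and [C] is positive definite. *)
Lemma moment_unit : M \in unitmx.
Proof.
apply: unitmx_row_kernel => v vM.
have v0 : v 0 ord0 = - \sum_k v 0 (lift ord0 k) * xi (enum_val k).
  have /rowP/(_ ord0) := vM; rewrite !mxE big_ord_recl M00 mulr1.
  move/eqP; rewrite addr_eq0 => /eqP->.
  by congr (- _); apply: eq_bigr => k _; rewrite Mk0.
pose w := extend_by_zero (fun k => v 0 (lift ord0 k)).
have wC l : l \in S -> (w *m C) 0 l = 0.
  move=> lS; have -> : l = enum_val (enum_rank_in lS l) by rewrite
    enum_rankK_in.
  move: (enum_rank_in _ _) => {lS}l.
  have /rowP/(_ (lift ord0 l)) vMl := vM; rewrite !mxE big_ord_recl M0k in vMl.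
  rewrite /w extend_mulmx -[RHS]vMl v0 mulNr mulr_suml -sumrN -big_split /=.
  by apply: eq_bigr => k _; rewrite Mkl; ring.
have w0 : w = 0.
  apply: contraTeq isT => /posC; rewrite mxE big1 ?ltxx // => l _.
  have [lS|lS] := boolP (l \in S); first by rewrite wC ?mul0r.
  by rewrite [_^T _ _]mxE extend_out ?mulr0.
have vk k : v 0 (lift ord0 k) = 0.
  by rewrite -(extend_enum_val (fun k => v 0 (lift ord0 k))) -/w w0 mxE.
apply/rowP => l; rewrite [RHS]mxE; case: (unliftP ord0 l) => [k ->|->] //.
by rewrite v0 big1 ?oppr0 // => k _; rewrite vk mul0r.
Qed.

(** The same elimination of the intercept shows that the regression with a
    constant has the slopes given by the covariances alone. *)
Lemma normal_equations (i : 'I_N) (b : 'cV[R]_(#|S|).+1) :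
    b ord0 0 = xi i ->
    (forall k, b (lift ord0 k) 0 = C (enum_val k) i + xi (enum_val k) * xi i) ->
  let beta := extend_by_zero (fun k => (invmx M *m b) (lift ord0 k) 0) in
  beta *m coord_proj R (~: S) = 0 /\
  (delta_mx 0 i - beta) *m C *m coord_proj R S = 0.
Proof.
move=> b0 bk; set theta := invmx M *m b; move=> beta.
have Mt : M *m theta = b by rewrite /theta mulKVmx ?moment_unit.
clearbody theta.
have t0 : theta ord0 0 = xi i - \sum_k xi (enum_val k) * theta (lift ord0 k) 0.
  rewrite -b0 -Mt mxE big_ord_recl M00 mul1r.
  by under eq_bigr => k _ do rewrite M0k; rewrite addrK.
split.
  by apply: mul_coord_proj_eq0 => m; rewrite finset.in_setC; exact: extend_out.
apply/rowP => l; rewrite mulmx_coord_proj [RHS]mxE.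
have [lS|lS] := boolP (l \in S); last by rewrite mulr0.
rewrite mulr1 mulmxBl mxE [X in _ + X]mxE -rowE [row _ _ _ _]mxE extend_mulmx.
have -> : l = enum_val (enum_rank_in lS l) by rewrite enum_rankK_in.
move: (enum_rank_in _ _) => {lS}l.
have symE x y : C x y = C y x by rewrite -[in LHS]symC mxE.
have := congr1 (fun c : 'cV_ _ => c (lift ord0 l) 0) Mt.
rewrite mxE big_ord_recl bk Mk0 t0 mulrBr => bl.
apply/eqP; rewrite subr_eq0; apply/eqP.
rewrite symE; apply: (addIr (xi (enum_val l) * xi i)); rewrite -bl.
rewrite -addrA addrC; congr (_ + _).
rewrite mulr_sumr -sumrN -big_split /=; apply: eq_bigr => k _.
by rewrite Mkl (symE (enum_val l)); ring.
Qed.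

End NormalEquations.

(** * Moments of the solution of the structural equations *)

Section Moments.
Variables (d : measure_display) (Omega : measurableType d) (R : realType).
Variable P : probability Omega R.

Lemma expectation_lincomb (I : finType) (a : I -> R) (f : I -> Omega -> R) :
    (forall i, f i \in Lfun P 1) ->
  fine 'E_P[fun w => \sum_i a i * f i w] = \sum_i a i * fine 'E_P[f i].
Proof.
move=> fL; have -> : (fun w => \sum_i a i * f i w) =
    \sum_(g <- [seq a i \o* f i | i <- index_enum I]) g.
  apply/funext => w; rewrite big_map fct_sumE.
  by apply: eq_bigr => i _ /=; rewrite mulrC.
rewrite expectation_sum => [|g /mapP[i _ ->]]; last exact: Lfun_scale.
rewrite big_map; under eq_bigr => i _ do
  rewrite expectationZl // -(fineK (expectation_fin_num (fL i))) -EFinM.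
by rewrite sumEFin.
Qed.

Variables (N : nat) (A : 'M[R]_N) (X u : 'I_N -> {RV P >-> R}).
Hypothesis u_L2 : forall i, (u i : Omega -> R) \in Lfun P 2%:E.
Hypothesis X_eq :
  forall i w, X i w = \sum_(j in parents A i) A i j * X j w + u i w.
Hypothesis lA : strictly_lower A.

Let L := resolvent A.
Let Sigma := error_variance u.
Let mu m : R := fine 'E_P[u m].
Let xi k : R := \sum_m L k m * mu m.

Lemma error_L1 m : (u m : Omega -> R) \in Lfun P 1.
Proof. by apply: Lfun_subset12 => //; rewrite fin_num_measure. Qed.

Lemma error_mul_L1 m n : (u m \* u n : Omega -> R) \in Lfun P 1.
Proof. exact: Lfun2_mul_Lfun1. Qed.

Lemma solution_error k w : X k w = \sum_m L k m * u m w.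
Proof.
pose x : 'cV[R]_N := \col_k X k w; pose e : 'cV[R]_N := \col_k u k w.
have xe : (1%:M - A) *m x = e.
  rewrite mulmxBl mul1mx; apply/colP => l; rewrite !mxE X_eq.
  rewrite [_ + u l w]addrC -[RHS]addr0 -addrA; congr (_ + _).
  apply/eqP; rewrite subr_eq0 big_mkcond; apply/eqP; apply: eq_bigr => m _.
  by rewrite inE mxE; case: eqP => [->|]; rewrite ?mul0r.
have /colP/(_ k) : x = L *m e by rewrite -xe mulmxA resolvent_mul // mul1mx.
by rewrite !mxE => ->; apply: eq_bigr => m _; rewrite mxE.
Qed.

Lemma error_varianceE m n :
  Sigma m n = fine 'E_P[u m \* u n] - mu m * mu n.
Proof.
rewrite mxE covarianceE ?error_L1 ?error_mul_L1 //.
by rewrite fineB ?fineM ?fin_numM ?expectation_fin_num ?error_L1 ?error_mul_L1.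
Qed.

Lemma error_variance_sym : Sigma^T = Sigma.
Proof. by apply/matrixP => m n; rewrite !mxE covarianceC. Qed.

Lemma solution_mean k : fine 'E_P[X k] = xi k.
Proof.
rewrite /xi /mu -(expectation_lincomb (L k) error_L1).
by congr (fine 'E_P[_]); apply/funext => w; exact: solution_error.
Qed.

Lemma solution_moment k l :
  fine 'E_P[X k \* X l] = (L *m Sigma *m L^T) k l + xi k * xi l.
Proof.
have -> : (X k \* X l : Omega -> R) = fun w => \sum_(p : 'I_N * 'I_N)
    (L k p.1 * L l p.2) * (u p.1 \* u p.2) w.
  apply/funext => w /=; rewrite !solution_error big_distrlr /= pair_big /=.
  by apply: eq_bigr => p _; rewrite mulrACA.
rewrite (expectation_lincomb _ (fun p => error_mul_L1 p.1 p.2)).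
rewrite -(pair_big xpredT xpredT (fun m n =>
  L k m * L l n * fine 'E_P[u m \* u n])) /=.
rewrite [xi k * xi l]big_distrlr /= exchange_big mxE [in RHS]exchange_big
  -big_split /=.
apply: eq_bigr => n _; rewrite !mxE mulr_suml -big_split /=.
by apply: eq_bigr => m _; rewrite error_varianceE; ring.
Qed.

Hypothesis posS : positive_definite Sigma.

Lemma posdef_row (v : 'rV[R]_N) : v != 0 -> 0 < (v *m Sigma *m v^T) 0 0.
Proof.
move=> v0; rewrite -{1}[v]trmxK; apply: posS.
by apply: contra_neq v0 => /(congr1 trmx); rewrite trmxK trmx0.
Qed.

Definition regression_row (i : 'I_N) (S : {set 'I_N}) : 'rV[R]_N :=
  extend_by_zero (fun k : 'I_#|S| => regression_vector X i S (lift ord0 k) 0).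

Lemma regression_coefE i k (Z : {set 'I_N}) :
  regression_coef X i k Z = regression_row i (k |: Z) 0 k.
Proof.
rewrite /regression_row -[X in _ = extend_by_zero _ 0 X](enum_rankK_in (setU11
  k Z) (setU11 k Z)).
by rewrite extend_enum_val.
Qed.

(** The regression coefficients are those of the normal equations for the
    covariance matrix L Sigma L^T of X = L u. *)
Lemma regression_rowP i (S : {set 'I_N}) :
  regression_row i S *m coord_proj R (~: S) = 0 /\
  (delta_mx 0 i - regression_row i S) *m (L *m Sigma *m L^T) *m coord_proj R S
    = 0.
Proof.
have reg0 : @regressor _ _ _ _ _ X S ord0 = cst 1.
  by rewrite /regressor unlift_none.
have regk k : @regressor _ _ _ _ _ X S (lift ord0 k) = X (enum_val k).
  by rewrite /regressor liftK.
have mul1 (f : Omega -> R) : cst 1 \* f = f by apply/funext => w /=; rewrite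
  mul1r.
have mulf1 (f : Omega -> R) : f \* cst 1 = f by apply/funext => w /=; rewrite
  mulr1.
apply: (normal_equations (xi := xi)).
- exact: posdef_congr posdef_row (resolvent_unit lA).
- by rewrite !trmx_mul trmxK error_variance_sym mulmxA.
- by rewrite mxE reg0 mul1 expectation_cst.
- by move=> k; rewrite mxE reg0 regk mul1 solution_mean.
- by move=> k; rewrite mxE reg0 regk mulf1 solution_mean.
- by move=> k l; rewrite mxE !regk solution_moment.
- by rewrite mxE reg0 mul1 solution_mean.
- by move=> k; rewrite mxE regk solution_moment.
Qed.

End Moments.

(** * Blocked back-door paths and the bias formula *)

Section BackdoorResidual.
Variables (d : measure_display) (Omega : measurableType d) (R : realType).
Variables (P : probability Omega R) (N : nat).
Variables (A : 'M[R]_N) (u : 'I_N -> {RV P >-> R}).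
Hypothesis posS : positive_definite (error_variance u).
Hypothesis lA : strictly_lower A.
Let G := causal_diagram A u.
Let Sigma := error_variance u.

Lemma directed_causal_diagram x y : directed G x y = (A y x != 0).
Proof. by rewrite /G /= inE. Qed.

Lemma bidirected_causal_diagram x y :
  x != y -> Sigma x y != 0 -> bidirected G y x.
Proof.
move=> xy; rewrite mxE covarianceC => Sxy.
by rewrite /= eq_sym xy; apply: contra_neq Sxy => ->.
Qed.

(** The set of the vertices of [S] that open walks from [k] reach with an
    arrowhead is a block of the covariance matrix of the residuals, by
    [reaches_trek]: from a vertex of this block every trek to a vertex of [S]
    extends the walk. If a residual of the block were correlated with that of
    [i], the walk would extend to [i] and yield an open back-door path. *)
Lemma blocked_residual_coef (S : {set 'I_N}) i k (delta : 'rV[R]_N) :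
    let E := resolvent (A *m coord_proj R (~: S)) in
    i \notin S -> k \in S -> blocks_backdoor G (S :\ k) k i ->
    delta *m coord_proj R (~: S) = 0 ->
    (delta_mx 0 i - delta) *m (E *m Sigma *m E^T) *m coord_proj R S = 0 ->
  delta 0 k = 0.
Proof.
move=> E iS kS block dS dO.
have lAS : strictly_lower (A *m coord_proj R (~: S)).
  exact: strictly_lower_mulmx_coord_proj.
have posO := posdef_congr (posdef_row posS) (resolvent_unit lAS).
pose K := [set l in S | `[< reaches G S k l true >]].
have kK : k \in K by rewrite inE kS; apply/asboolP/reaches_source.
have trek l x : l \in K -> x != k -> (E *m Sigma *m E^T) x l != 0 ->
    exists a, reaches G S k x a /\ (x \in S -> a).
  rewrite inE => /andP[lS /asboolP rl] xk.
  apply: (reaches_trek lA directed_causal_diagram bidirected_causal_diagram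
    kS lS rl xk).
have : delta *m coord_proj R K = 0.
  apply: (regression_vanish (i := i) posO dS dO).
  - by apply/fintype.subsetP => l; rewrite inE => /andP[].
  - move=> x xK; apply/eqP; apply: contraT => /(trek _ _ xK)[].
      by apply: contraNneq iS => ->.
    move=> a [/(reaches_opens kS iS)[s [bs nb]] _].
    by case: nb; exact: block.
  move=> l x lS lK xK; apply/eqP; apply: contraT => /(trek _ _ xK)[].
    by apply: contraNneq lK => ->.
  by case=> -[rl /(_ lS) // _]; case/negP: lK; rewrite inE lS; apply/asboolP.
by move/rowP/(_ k); rewrite mulmx_coord_proj kK mulr1 mxE.
Qed.

End BackdoorResidual.

Theorem theorem3p6 (d : measure_display) (Omega : measurableType d)
    (R : realType) (P : probability Omega R) (N : nat)
    (A : 'M[R]_N) (X u : 'I_N -> {RV P >-> R})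
    (u_L2 : forall i, (u i : Omega -> R) \in Lfun P 2%:E)
    (X_var : forall i, 'V_P[X i] != 0%E)
    (X_eq : forall i w, X i w = \sum_(j in parents A i) A i j * X j w + u i w)
    (Sigma_posdef : positive_definite (error_variance u))
    (A_trig : is_trig_mx A) (A_diag : forall i, A i i = 0)
    (i j : 'I_N) (neq_ij : i != j)
    (Z : {set 'I_N}) (iZ : i \notin Z) (jZ : j \notin Z)
    (Z_blocks : blocks_backdoor (causal_diagram A u) Z j i) :
  let S := j |: Z in
  let S1 := opening_set A u i S in
  let S2 := blocking_set A u i S in
  bias A X u i j Z =
    - \sum_(p in S1)
        bias A X u i p (S :\ p) * controlled_effect A u p j (S2 :\ j).
Proof.
move=> S S1 S2.
have lA : strictly_lower A.
  move=> a b; apply: contraNltn; rewrite leq_eqVlt => /orP[/eqP ab|ab].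
    by rewrite (val_inj ab : a = b) A_diag.
  by move/is_trig_mxP: A_trig => ->.
have iS : i \notin S by rewrite !inE negb_or neq_ij.
have jS : j \in S by rewrite setU11.
have SjZ : S :\ j = Z by rewrite setU1K.
pose B := resolvent (A *m coord_proj R (~: S)) *m A *m coord_proj R S.
pose gamma := regression_row X i S - row i B.
(* An effect out of b under an intervention on W :\ b is an entry of the
   resolvent for W, since paths out of b do not return to b. *)
have effectE (W : {set 'I_N}) a b : b \in W -> controlled_effect A u a b (W :\
  b) =
    resolvent (coord_proj R (~: W) *m A) a b.
  move=> bW; exact: (total_effect_resolvent lA (directed_causal_diagram A u)).
have biasE k : k \in S -> bias A X u i k (S :\ k) = gamma 0 k.
  move=> kS; rewrite /bias regression_coefE finset.setD1K // effectE //.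
  by rewrite -projected_effect // !mxE.
have [beta_supp beta_normal] := regression_rowP u_L2 X_eq lA Sigma_posdef i S.
have [delta [delta_supp delta_normal gammaE]] :=
  bias_decomposition lA beta_supp beta_normal.
have gamma_supp p : p \notin S -> gamma 0 p = 0.
  move=> pS; have /rowP/(_ p) := beta_supp.
  rewrite mulmx_coord_proj finset.in_setC pS mulr1 [RHS]mxE => bp.
  by rewrite mxE bp add0r 2!mxE mulmx_coord_proj (negbTE pS) mulr0 oppr0.
have S2S : S2 \subset S by apply/fintype.subsetP => k; rewrite inE => /andP[].
have jS2 : j \in S2 by rewrite inE jS SjZ; apply/asboolP.
have delta_S2 : delta *m coord_proj R S2 = 0.
  apply: mul_coord_proj_eq0 => k; rewrite inE => /andP[kS /asboolP block].
  exact: blocked_residual_coef iS kS block delta_supp delta_normal.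
have /rowP/(_ j) := bias_orthogonal lA S2S delta_S2.
rewrite -gammaE mulmx_coord_proj jS2 mulr1 [RHS]mxE mxE.
set M := resolvent (coord_proj R (~: S2) *m A) => orth.
(* Nothing enters S2, so on S2 only the empty path contributes. *)
have M_S2 p : p \in S2 -> M p j = (p == j)%:R.
  move=> pS2; rewrite /M resolventEl; last exact:
    strictly_lower_coord_proj_mulmx.
  by rewrite mxE -mulmxA coord_proj_mulmx finset.in_setC pS2 mul0r addr0 mxE.
rewrite -SjZ biasE //; apply/eqP; rewrite -addr_eq0 -[X in _ == X]orth;
  apply/eqP.
rewrite [RHS](bigD1 j) //= M_S2 // eqxx mulr1; congr (_ + _).
rewrite big_mkcond [RHS]big_mkcond; apply: eq_bigr => p _.
have [pS|pS] := boolP (p \in S); last first.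
  by rewrite inE (negbTE pS) gamma_supp // mul0r; case: ifP.
have [pS2|pS2] := boolP (p \in S2).
  rewrite M_S2 // ifF; first by case: eqP; rewrite ?mulr0.
  apply/negP; rewrite inE => /andP[_ /asboolP[s [bs nb]]]; apply: nb.
  by move: pS2; rewrite inE => /andP[_ /asboolP]; apply.
rewrite ifT; last first.
  move: pS2; rewrite [p \in S2]inE [p \in S1]inE pS /= => /asboolPn nb;
    apply/asboolP.
  apply: contrapT => no; apply: nb => s bs; apply: contrapT => nbs.
  by apply: no; exists s.
have pj : p != j by apply: contraNneq pS2 => ->.
by rewrite pj biasE // effectE.
Qed.
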